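(* The monotone graph property ''connected'' is $\mathcal F_{[\omega]^2}$-hard on the vertex set $\omega$.
   Context: $\mathcal F_{[\omega]^2}=\{F\subseteq[\omega]^2:\exists W\subseteq\omega\text{ infinite with }[W]^2\subseteq F\}$. Game $\mathbb E_{\omega,R,\mathcal F}$ (for a property $R$ and an upward closed $\mathcal F\subseteq\mathcal P([\omega]^2)$): a pregraph on $\omega$ is $\langle\omega,E,N\rangle$ with $E,N\subseteq[\omega]^2$ disjoint (edges, nonedges; $P=E\cup N$ determined pairs); a graph $\langle\omega,E'\rangle$ extends it if $E\subseteq E'$ and $E'\cap N=\emptyset$. Alice and Bob build a transfinite sequence of pregraphs starting with $\langle\omega,\emptyset,\emptyset\rangle$, taking unions at limits; at successor steps Alice picks an undetermined pair and Bob declares it edge or nonedge. The game terminates at the first stage $\beta$ at which either every graph extending the current pregraph has $R$ or none does. Bob wins iff the set $P_\beta$ of determined pairs at termination belongs to $\mathcal F$. $R$ is $\mathcal F$-hard on $\omega$ iff Alice has no winning strategy in this game. *)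

(* Defs.v *)
From mathcomp Require Import all_boot finmap.
From mathcomp Require Import boolp classical_sets cardinality wochoice.

Set Implicit Arguments.
Unset Strict Implicit.
Unset Printing Implicit Defensive.

Local Open Scope classical_set_scope.

(* [omega]^2 *)
Definition vpair : Type := {e : {fset nat} | #|` e| == 2}.

(* [W]^2 *)
Definition pairs_of (W : set nat) : set vpair :=
  [set e | forall x : nat, x \in val e -> W x].

Definition F_omega2 : set (set vpair) :=
  [set F | exists W : set nat, infinite_set W /\ pairs_of W `<=` F].

Definition upward_closed (F : set (set vpair)) : Prop :=
  forall A B : set vpair, A `<=` B -> F A -> F B.

(* A graph on omega is given by its edge set; a graph property is a set of
   graphs. *)
Notation graph := (set vpair).

Definition adjacent (E : graph) (x y : nat) : Prop :=
  exists2 e : vpair, E e & val e = [fset x; y]%fset.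

Definition graph_connected : set graph :=
  [set E | forall x y : nat, exists2 s : seq nat,
     path (fun u v => `[< adjacent E u v >]) x s & last x s = y].

Definition monotone_property (R : set graph) : Prop :=
  forall E E' : graph, E `<=` E' -> R E -> R E'.

Record pregraph := Pregraph {
  edges : set vpair;
  nonedges : set vpair;
  pregraph_disjoint : edges `&` nonedges = set0 }.

Definition determined (G : pregraph) : set vpair := edges G `|` nonedges G.

Definition extends (E' : graph) (G : pregraph) : Prop :=
  edges G `<=` E' /\ E' `&` nonedges G = set0.

Definition decided (R : set graph) (G : pregraph) : Prop :=
  (forall E', extends E' G -> R E') \/ (forall E', extends E' G -> ~ R E').

(* One round at G: Alice picks the undetermined pair e, and Bob's declaration
   turns G into H. *)
Definition round (e : vpair) (G H : pregraph) : Prop :=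
  ~ determined G e /\
  ((edges H = e |` edges G /\ nonedges H = nonedges G) \/
   (edges H = edges G /\ nonedges H = e |` nonedges G)).

(* Stages are indexed by a well-ordered type (I, le) in place of the ordinals;
   only the stages up to a given b : I are ever used, so that (I, le, b)
   stands for the ordinal of b. *)
Definition stage_lt (I : eqType) (le : rel I) (a b : I) : Prop :=
  le a b /\ a <> b.

Definition is_first (I : eqType) (le : rel I) (a : I) : Prop :=
  forall c, ~ stage_lt le c a.

Definition is_succ (I : eqType) (le : rel I) (a b : I) : Prop :=
  stage_lt le a b /\ forall c, ~ (stage_lt le a c /\ stage_lt le c b).

Definition is_limit (I : eqType) (le : rel I) (b : I) : Prop :=
  ~ is_first le b /\ forall a, ~ is_succ le a b.

(* The pregraphs (G a), a <= b, are the stages of a play of the game for R that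
   has not terminated before stage b. *)
Record play (R : set graph) (I : eqType) (le : rel I)
    (G : I -> pregraph) (b : I) : Prop := Play {
  play_wo : well_order le;
  play_first : forall a, le a b -> is_first le a ->
    edges (G a) = set0 /\ nonedges (G a) = set0;
  play_succ : forall a c, le c b -> is_succ le a c ->
    exists e, round e (G a) (G c);
  play_limit : forall c, le c b -> is_limit le c ->
    edges (G c) = \bigcup_(a in [set a | stage_lt le a c]) edges (G a) /\
    nonedges (G c) = \bigcup_(a in [set a | stage_lt le a c]) nonedges (G a);
  play_undecided : forall a, stage_lt le a b -> ~ decided R (G a) }.

(* The sequence of pregraphs up to stage a is strictly increasing, so it can be
   recovered from the set of its terms, ordered by inclusion. This set is the
   history on which Alice's next choice may depend. *)
Definition history (I : eqType) (le : rel I) (G : I -> pregraph) (a : I) :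
    set pregraph :=
  [set G c | c in [set c | le c a]].

Definition strategy := set pregraph -> vpair.

Definition legal_strategy (R : set graph) (sigma : strategy) : Prop :=
  forall (I : eqType) (le : rel I) (G : I -> pregraph) (b : I),
    play R le G b -> ~ decided R (G b) ->
    ~ determined (G b) (sigma (history le G b)).

Definition follows (sigma : strategy) (I : eqType) (le : rel I)
    (G : I -> pregraph) (b : I) : Prop :=
  forall a c, le c b -> is_succ le a c ->
    round (sigma (history le G a)) (G a) (G c).

Definition winning_for_Alice (R : set graph) (F : set (set vpair))
    (sigma : strategy) : Prop :=
  legal_strategy R sigma /\
  forall (I : eqType) (le : rel I) (G : I -> pregraph) (b : I),
    play R le G b -> decided R (G b) -> follows sigma le G b ->
    ~ F (determined (G b)).

Definition hard (R : set graph) (F : set (set vpair)) : Prop :=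
  ~ exists sigma : strategy, winning_for_Alice R F sigma.

Lemma F_omega2_upward_closed : upward_closed F_omega2.
Proof.
by move=> A B AB [W [Winf WA]]; exists W; split=> // e /WA /AB.
Qed.

Lemma graph_connected_monotone : monotone_property graph_connected.
Proof.
move=> E E' EE' cE x y; have [s ps <-] := cE x y; exists s => //.
apply: sub_path ps => u v /asboolP[e Ee ve]; apply/asboolP; exists e => //.
exact: EE'.
Qed.

(* Main.v *)
(* Bob declares a pair to be an edge only when it is the last undetermined pair
   between the components of its endpoints. All pairs inside a component of the
   current edge set are then determined, and two distinct finite components
   always have an undetermined pair between them. At termination some component
   W is infinite, so that [W]^2 is determined: if the edges already connect
   omega then W = omega, and if all components were finite then declaring every
   undetermined pair an edge would connect the graph, so the
   property would not have been decided negatively.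
   Plays are run along a well-ordering of the uncountable type [set nat]; they
   terminate because Alice's successive moves are distinct elements of the
   countable type [vpair]. *)

Require Import Defs.
From mathcomp Require Import all_boot finmap.
From mathcomp Require Import boolp classical_sets cardinality wochoice.

Set Implicit Arguments.
Unset Strict Implicit.
Unset Printing Implicit Defensive.

Local Open Scope classical_set_scope.

(** * Pairs and connectivity *)

Definition joins (e : vpair) (x y : nat) : Prop := val e = [fset x; y]%fset.

Lemma joins_sym e x y : joins e x y -> joins e y x.
Proof. by rewrite /joins fsetUC. Qed.

Lemma joins_neq e x y : joins e x y -> x <> y.
Proof.
rewrite /joins => eE xy; move: (valP e); rewrite /= eE xy.
by rewrite cardfs2 eqxx.
Qed.

Lemma joins_exists x y : x <> y -> exists e, joins e x y.
Proof.
move=> /eqP xy; have h : #|` [fset x; y]%fset| == 2 by rewrite cardfs2 xy.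
by exists (exist (fun e : {fset nat} => #|` e| == 2) _ h).
Qed.

Lemma joins_ends e : exists x y, joins e x y.
Proof.
have /eqP e2 := valP e; have /fset0Pn[x xe] : val e != fset0.
  by rewrite -cardfs_gt0 e2.
have : #|` (val e `\ x)%fset| = 1%N by move: (cardfsD1 x (val e)); rewrite xe e2 => -[].
move=> /eqP/cardfs1P[y yE]; exists x, y; rewrite /joins.
by rewrite -(fsetD1K xe) yE.
Qed.

Lemma joins_unique e f x y : joins e x y -> joins f x y -> e = f.
Proof. by move=> ex fx; apply/val_inj; rewrite ex fx. Qed.

Lemma joins_inj e a b c d : joins e a b -> joins e c d ->
  (a = c /\ b = d) \/ (a = d /\ b = c).
Proof.
move=> ab cd; have nab := joins_neq ab.
have E z : (z == a) || (z == b) = (z == c) || (z == d).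
  by rewrite -!in_fset2 -[[fset a; b]%fset]ab cd.
have := E a; have := E b; rewrite !eqxx ?orbT /=.
by move=> /esym/orP[]/eqP ? /esym/orP[]/eqP ?; subst; auto; case: nab.
Qed.

(** Walks grow at their far end, so that induction replaces reasoning about vertex sequences;
    [graph_connectedP] gives the link with paths. *)
Inductive connects (E : graph) (x : nat) : nat -> Prop :=
| connects_refl : connects E x x
| connects_step y z e :
    connects E x y -> E e -> joins e y z -> connects E x z.

Lemma connects_trans E x y z :
  connects E x y -> connects E y z -> connects E x z.
Proof. by move=> xy; elim=> // u v e _ xu Ee uv; exact: connects_step uv. Qed.

Lemma connects_edge E x y e : E e -> joins e x y -> connects E x y.
Proof. by move=> Ee xy; apply: connects_step xy => //; exact: connects_refl. Qed.

Lemma connects_sym E x y : connects E x y -> connects E y x.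
Proof.
elim=> [|u v e _ ux Ee uv]; first exact: connects_refl.
exact: connects_trans (connects_edge Ee (joins_sym uv)) ux.
Qed.

Lemma connects_sub E E' x y : E `<=` E' -> connects E x y -> connects E' x y.
Proof.
move=> EE'; elim=> [|u v e _ xu /EE' Ee uv]; first exact: connects_refl.
exact: connects_step uv.
Qed.

(** A walk may cross [e] repeatedly, but a repeated crossing can be cut out, so at most one
    crossing, in one of two directions, has to be recorded. *)
Lemma connects_add E e u v x y : joins e u v -> connects (e |` E) x y ->
  [\/ connects E x y, connects E x u /\ connects E v y |
      connects E x v /\ connects E u y].
Proof.
move=> euv; elim=> [|a b f _ IH [->|Ef] ab].
- by constructor 1; exact: connects_refl.
- have R z := connects_refl E z.
  case: (joins_inj euv ab) => -[? ?]; subst a b;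
  by case: IH => [?|[? ?]|[? ?]];
    solve [constructor 1; eauto using connects_trans
          |constructor 2; eauto using connects_trans
          |constructor 3; eauto using connects_trans].
- case: IH => [?|[? ?]|[? ?]]; [constructor 1|constructor 2|constructor 3];
  by try split => //; exact: connects_step ab.
Qed.

Lemma graph_connectedP E :
  graph_connected E <-> forall x y, connects E x y.
Proof.
split=> [cE x y|cE x y].
  have [s ps <-] := cE x y; elim/last_ind: s ps => [_|s z IH].
    exact: connects_refl.
  rewrite rcons_path last_rcons => /andP[/IH xs /asboolP[e Ee ez]].
  exact: connects_step ez.
elim: (cE x y) => [|u v e _ [s ps su] Ee uv]; first by exists [::].
exists (rcons s v); rewrite ?last_rcons// rcons_path ps su /=.
by apply/asboolP; exists e.
Qed.

Definition component (E : graph) (x : nat) : set nat := [set y | connects E x y].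

(** * Bob's strategy *)

Lemma add_edge_disjoint (G : pregraph) e : ~ determined G e ->
  (e |` edges G) `&` nonedges G = set0.
Proof.
move=> ne; apply/seteqP; split=> // f [[->|Ef] Nf]; first by apply: ne; right.
by rewrite -(pregraph_disjoint G).
Qed.

Lemma add_nonedge_disjoint (G : pregraph) e : ~ determined G e ->
  edges G `&` (e |` nonedges G) = set0.
Proof.
move=> ne; apply/seteqP; split=> // f [Ef [fe|Nf]].
  by apply: ne; left; rewrite -fe.
by rewrite -(pregraph_disjoint G).
Qed.

Definition last_pair (G : pregraph) (e : vpair) : Prop :=
  forall x y a b f, joins e x y -> connects (edges G) x a ->
    connects (edges G) y b -> joins f a b -> f = e \/ determined G f.

(** Made total by ignoring an illegal move, so that the play can be constructed before Alice's moves
    are known to be legal. *)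
Definition bob (G : pregraph) (e : vpair) : pregraph :=
  match pselect (determined G e) with
  | left _ => G
  | right ne => if `[< last_pair G e >] then Pregraph (add_edge_disjoint ne)
                else Pregraph (add_nonedge_disjoint ne)
  end.

Variant bob_spec (G : pregraph) (e : vpair) (H : pregraph) : Prop :=
| BobSkip of determined G e & H = G
| BobEdge of ~ determined G e & last_pair G e &
    edges H = e |` edges G & nonedges H = nonedges G
| BobNonedge of ~ determined G e & ~ last_pair G e &
    edges H = edges G & nonedges H = e |` nonedges G.

Lemma bobP G e : bob_spec G e (bob G e).
Proof.
rewrite /bob; case: pselect => [d|nd]; first exact: BobSkip.
by case: asboolP => lp; [exact: BobEdge|exact: BobNonedge].
Qed.

Lemma bob_edges G e : edges G `<=` edges (bob G e).
Proof. by move=> f Ef; case: (bobP G e) => [_ ->|_ _ -> _|_ _ -> _] //; right. Qed.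

Lemma bob_nonedges G e : nonedges G `<=` nonedges (bob G e).
Proof. by move=> f Nf; case: (bobP G e) => [_ ->|_ _ _ ->|_ _ _ ->] //; right. Qed.

Lemma bob_determined G e f :
  determined (bob G e) f <-> f = e \/ determined G f.
Proof.
rewrite /determined; case: (bobP G e) => [d ->|_ _ -> ->|_ _ -> ->].
- by split=> [|[->|]]; [right| |].
- by split=> [[[]|]|[|[]]]; rewrite /setU /=; tauto.
- by split=> [[|[]]|[|[]]]; rewrite /setU /=; tauto.
Qed.

Lemma bob_round G e : ~ determined G e -> round e G (bob G e).
Proof. by move=> nd; split=> //; case: (bobP G e) => // *; [left|right]. Qed.

(** * Two invariants of Bob's answers *)

Definition components_determined (G : pregraph) : Prop :=
  forall x y e, connects (edges G) x y -> joins e x y -> determined G e.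

(** Finiteness lets this pass to limit stages: between infinite components all pairs may become
    determined in the limit without any of them ever having been the last one. *)
Definition components_open (G : pregraph) : Prop :=
  forall x y, finite_set (component (edges G) x) ->
    finite_set (component (edges G) y) -> ~ connects (edges G) x y ->
    exists a b f, [/\ connects (edges G) x a, connects (edges G) y b,
                      joins f a b & ~ determined G f].

(** A new edge merges two components only when it was the last pair between them, so every pair
    across is [e] or already determined. *)
Lemma bob_components_determined G e :
  components_determined G -> components_determined (bob G e).
Proof.
move=> cG x y f xy fxy; apply/bob_determined.
case: (bobP G e) xy => [_ -> xy|_ lp -> _ xy|_ _ -> _ xy]; try by right; exact: cG fxy.
have [u [v uv]] := joins_ends e; case: (connects_add uv xy) => [h|[xu vy]|[xv uy]].
- by right; exact: cG fxy.
- exact: (lp u v x y) (connects_sym xu) vy fxy.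
- exact: (lp v u x y) (joins_sym uv) (connects_sym xv) uy fxy.
Qed.

Lemma bob_components_open G e :
  components_open G -> components_open (bob G e).
Proof.
move=> cG x y; have := @bob_determined G e; have sub := @bob_edges G e.
have fin z : finite_set (component (edges (bob G e)) z) ->
    finite_set (component (edges G) z).
  by apply: sub_finite_set => t; exact: connects_sub.
move: sub fin; case: (bobP G e) => [_ ->|nd lp -> _|nd lp -> _] sub fin detE.
- exact: cG.
- move=> /fin fx /fin fy nxy; case: (cG x y) => //.
    by move=> h; apply: nxy; exact: connects_sub h.
  move=> a [b [f [xa yb fab ndf]]]; exists a, b, f.
  split=> //; try exact: connects_sub sub _.
  (* An open pair of [G] is lost only if it is [e]; but then the new edge connects [x] to [y]. *)
  move=> /detE[fe|//]; subst f; apply: nxy.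
  apply: connects_trans (connects_sub sub xa) _.
  apply: connects_trans (connects_sym (connects_sub sub yb)).
  by apply: connects_edge fab; left.
- move=> fx fy nxy; case: (cG x y) => // a [b [f [xa yb fab ndf]]].
  have [fe|fe] := pselect (f = e); last by exists a, b, f; split=> // /detE[].
  (* The open pair was [e] itself. If no other were left, [e] would have been the last pair,
     contradicting [lp]. The two cases below are the orientations of [e]. *)
  subst f; apply: contrapT => nex; apply: lp => u v c d f uv uc vd fcd.
  apply: contrapT => /not_orP[fe ndf']; apply: nex.
  case: (joins_inj fab uv) => -[? ?]; subst u v.
    exists c, d, f; split=> //; [exact: connects_trans uc|exact: connects_trans vd|].
    by move=> /detE[].
  exists d, c, f; split=> //; [exact: connects_trans vd|exact: connects_trans uc| |].
    exact: joins_sym.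
  by move=> /detE[].
Qed.

Lemma decided_F_omega2 G : components_determined G -> components_open G ->
  decided graph_connected G -> F_omega2 (determined G).
Proof.
move=> cd co dG.
suff [x xinf] : exists x, infinite_set (component (edges G) x).
  exists (component (edges G) x); split=> // e eW.
  have [p [q pq]] := joins_ends e; apply: (cd p q e _ pq).
  by apply: connects_trans (connects_sym (eW p _)) (eW q _);
    rewrite pq !inE eqxx ?orbT.
have sub : edges G `<=` ~` nonedges G.
  move=> e Ee Ne; have : (edges G `&` nonedges G) e by [].
  by rewrite pregraph_disjoint.
case: dG => dG.
  (* A positive decision is tested on the least extension of [G], its own edge set. *)
  exists 0; have /graph_connectedP cE : graph_connected (edges G).
    by apply: dG; split=> //; exact: pregraph_disjoint.
  move=> fin; apply: infinite_nat; apply: sub_finite_set fin => y _; exact: cE.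
(* A negative decision is tested on the greatest extension, where every undetermined pair is an
   edge. *)
apply: contrapT => /forallNP fin; apply: (dG (~` nonedges G)).
  by split; last rewrite setICl.
apply/graph_connectedP => x y.
have [xy|nxy] := pselect (connects (edges G) x y); first exact: connects_sub xy.
have {}fin z : finite_set (component (edges G) z) by apply: contrapT; exact: fin.
have [a [b [f [xa yb fab ndf]]]] := co x y (fin x) (fin y) nxy.
apply: connects_trans (connects_sub sub xa) _.
apply: connects_trans (connects_sym (connects_sub sub yb)).
by apply: connects_edge fab => Nf; apply: ndf; right.
Qed.

(** * Transfinite plays *)

Section WellOrder.
Context (I : eqType) (le : rel I) (wo : well_order le).

Local Notation lt := (stage_lt le).

(** [well_order] speaks only of unique minima of nonempty sets. The order axioms are recovered below
    from minima of sets of two or three elements, antisymmetry using the uniqueness. *)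
Lemma wo_min (P : I -> Prop) :
  (exists x, P x) -> exists2 z, P z & forall y, P y -> le z y.
Proof.
case=> x Px; have [|z [[/asboolP Pz zmin] _]] := wo (A := [pred x | `[< P x >]]).
  by exists x; apply/asboolP.
by exists z => // y Py; apply/zmin/asboolP.
Qed.

Lemma wo_total x y : le x y \/ le y x.
Proof.
have [|z [->|->] zmin] := @wo_min (fun z => z = x \/ z = y).
- by exists x; left.
- by left; apply: zmin; right.
- by right; apply: zmin; left.
Qed.

Lemma wo_refl x : le x x. Proof. by case: (wo_total x x). Qed.

Lemma wo_anti x y : le x y -> le y x -> x = y.
Proof.
move=> xy yx; have [|z [_ zU]] := wo (A := pred2 x y).
  by exists x; rewrite !inE eqxx.
have E t : t \in pred2 x y -> z = t.
  move=> tA; apply: zU; split=> // s; move: tA; rewrite !inE.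
  by move=> /orP[]/eqP-> /orP[]/eqP-> //; exact: wo_refl.
by rewrite -(E x) ?(E y)// !inE eqxx ?orbT.
Qed.

Lemma wo_trans x y z : le x y -> le y z -> le x z.
Proof.
move=> xy yz; have [|m mE mmin] := @wo_min (fun t => [\/ t = x, t = y | t = z]).
  by exists x; constructor 1.
have mx : le m x by apply: mmin; constructor 1.
have my : le m y by apply: mmin; constructor 2.
have mz : le m z by apply: mmin; constructor 3.
by case: mE => E; subst m => //; [rewrite (wo_anti xy mx)|rewrite -(wo_anti yz my)].
Qed.

Lemma wo_leVlt x y : le x y \/ lt y x.
Proof.
have [?|nxy] := pselect (le x y); [by left|right].
case: (wo_total x y) => // yx; split=> // E; apply: nxy.
by rewrite E; exact: wo_refl.
Qed.

Lemma wo_lt_irrefl x : ~ lt x x. Proof. by case. Qed.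

Lemma wo_le_lt_trans x y z : le x y -> lt y z -> lt x z.
Proof.
move=> xy [yz nyz]; split; first exact: wo_trans yz.
by move=> E; subst z; apply: nyz; exact: wo_anti.
Qed.

Lemma wo_lt_le_trans x y z : lt x y -> le y z -> lt x z.
Proof.
move=> [xy nxy] yz; split; first exact: wo_trans yz.
by move=> E; subst z; apply: nxy; exact: wo_anti.
Qed.

Lemma wo_lt_wf : well_founded lt.
Proof.
move=> x; apply: contrapT => nx.
have [|z nz zmin] := @wo_min (fun z => ~ Acc lt z); first by exists x.
apply: nz; constructor => y yz; apply: contrapT => /zmin zy.
exact: (@wo_lt_irrefl y) (wo_lt_le_trans yz zy).
Qed.

Lemma is_succ_le a b c : is_succ le a b -> lt c b -> le c a.
Proof. by move=> [_ ab] cb; case: (wo_leVlt c a) => // ac; case: (ab c). Qed.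

Lemma is_succ_inj a a' b : is_succ le a b -> is_succ le a' b -> a = a'.
Proof.
move=> ab a'b; apply: wo_anti; first exact: is_succ_le a'b ab.1.
exact: is_succ_le ab a'b.1.
Qed.

Lemma succ_exists a b : lt a b -> exists2 c, is_succ le a c & le c b.
Proof.
move=> ab; have [|c ac cmin] := @wo_min (lt a); first by exists b.
exists c; last exact: cmin.
by split=> // d [/cmin cd dc]; exact: (@wo_lt_irrefl d) (wo_lt_le_trans dc cd).
Qed.

Lemma lt_directed c d b : lt c b -> lt d b ->
  exists2 m, lt m b & le c m /\ le d m.
Proof.
move=> cb db; case: (wo_total c d) => [cd|dc]; [exists d => //|exists c => //];
by split=> //; exact: wo_refl.
Qed.

(** Used at limits to find one earlier stage at which finitely many persistent facts all hold. The
    second hypothesis serves the empty sequence. *)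
Lemma eventually_all (T : eqType) (P : T -> I -> Prop) (s : seq T) b :
  (forall t c d, le c d -> P t c -> P t d) ->
  (exists c, lt c b) -> (forall t, t \in s -> exists2 c, lt c b & P t c) ->
  exists2 c, lt c b & forall t, t \in s -> P t c.
Proof.
move=> Pmono [c0 c0b]; elim: s => [_|t s IH ex]; first by exists c0.
have [|c cb cP] := IH; first by move=> u us; apply: ex; rewrite inE us orbT.
have [d db dP] := ex t (mem_head _ _).
case: (wo_total c d) => [cd|dc]; [exists d => // u|exists c => // u];
  rewrite inE => /orP[/eqP->//|/cP cu] //.
  exact: Pmono cd cu.
exact: Pmono dc dP.
Qed.

(** * Bob's play against a fixed strategy, by transfinite recursion *)

Context (sigma : strategy).

(** Removing the edges from the nonedges makes disjointness hold for arbitrary [g]; by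
    [nonedges_union] nothing is removed when the stages increase. *)
Definition union_pregraph (A : set I) (g : I -> pregraph) : pregraph :=
  Pregraph (setDIK (\bigcup_(a in A) edges (g a)) (\bigcup_(a in A) nonedges (g a))).

(** The union branch also covers the first stage, as an empty union. *)
Definition next_stage (b : I) (g : I -> pregraph) : pregraph :=
  match pselect (exists a, is_succ le a b) with
  | left h => bob (g (sval (cid h))) (sigma (history le g (sval (cid h))))
  | right _ => union_pregraph [set a | lt a b] g
  end.

Lemma next_stage_ext b g g' :
  (forall a, lt a b -> g a = g' a) -> next_stage b g = next_stage b g'.
Proof.
move=> gg'; rewrite /next_stage; case: pselect => [h|_].
  case: (cid h) => a [ab _] /=; rewrite (gg' a ab); congr (bob _ (sigma _)).
  apply/seteqP; split=> _ [c ca <-]; exists c => //; [symmetry|];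
  by apply: gg'; exact: wo_le_lt_trans ab.
have E (F : pregraph -> set vpair) :
    \bigcup_(a in [set a | lt a b]) F (g a) = \bigcup_(a in [set a | lt a b]) F (g' a).
  by apply: eq_bigcupr => a ab; rewrite (gg' a ab).
(* The disjointness proofs are generalized so that [E] can rewrite in their types. *)
by rewrite /union_pregraph; move: (setDIK _ _) (setDIK _ _); rewrite !E => p q;
  congr Pregraph; exact: Prop_irrelevance.
Qed.

(** The empty pregraph is a default outside the initial segment below [b]; by [next_stage_ext] its
    value does not matter. *)
Definition stage : I -> pregraph :=
  Fix wo_lt_wf (fun=> pregraph) (fun b f => next_stage b (fun a =>
    match pselect (lt a b) with
    | left ab => f a ab
    | right _ => Pregraph (set0I set0)
    end)).

Lemma stageE b : stage b = next_stage b stage.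
Proof.
rewrite {1}/stage Fix_eq => [|c f g fg].
  by apply: next_stage_ext => a ab; case: pselect.
by apply: next_stage_ext => a ac; case: pselect.
Qed.

Lemma stage_succ a b : is_succ le a b ->
  stage b = bob (stage a) (sigma (history le stage a)).
Proof.
move=> ab; rewrite stageE /next_stage; case: pselect => [h|]; last by case; exists a.
by case: (cid h) => a' a'b /=; rewrite (is_succ_inj ab a'b).
Qed.

Lemma stage_nosucc b : (forall a, ~ is_succ le a b) ->
  stage b = union_pregraph [set a | lt a b] stage.
Proof.
move=> nb; rewrite stageE /next_stage; case: pselect => [h|//].
by case: (h) => a ab; case: (nb a ab).
Qed.

(** A nonedge of one stage that is an edge of another would be both at the later of the two.
    Monotonicity is assumed only below [b], so that the lemma can serve in the induction for
    [stage_mono]. *)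
Lemma nonedges_union b :
  (forall c d, le c d -> lt d b -> edges (stage c) `<=` edges (stage d) /\
     nonedges (stage c) `<=` nonedges (stage d)) ->
  nonedges (union_pregraph [set a | lt a b] stage) =
    \bigcup_(a in [set a | lt a b]) nonedges (stage a).
Proof.
move=> mono; apply/seteqP; split=> [e []//|e [a ab Na]].
split; first by exists a.
move=> [c cb Ec]; suff [d] : exists d, (edges (stage d) `&` nonedges (stage d)) e.
  by rewrite pregraph_disjoint.
case: (wo_total a c) => h; [exists c; split=> //|exists a; split=> //].
- exact: (mono _ _ h cb).2.
- exact: (mono _ _ h ab).1.
Qed.

Lemma stage_mono c d : le c d ->
  edges (stage c) `<=` edges (stage d) /\ nonedges (stage c) `<=` nonedges (stage d).
Proof.
elim/(well_founded_ind wo_lt_wf): d c => d IH c cd.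
have [->|ncd] := pselect (c = d); first by split.
have cltd : lt c d by split.
have [[a ad]|/forallNP nd] := pselect (exists a, is_succ le a d).
  have [Es Ns] := IH a ad.1 c (is_succ_le ad cltd).
  rewrite (stage_succ ad); split.
    exact: subset_trans Es (@bob_edges _ _).
  exact: subset_trans Ns (@bob_nonedges _ _).
rewrite (stage_nosucc nd).
rewrite nonedges_union => [|u v uv vd]; last exact: IH.
by split=> e ce; exists c.
Qed.

Lemma determined_mono c d :
  le c d -> determined (stage c) `<=` determined (stage d).
Proof. by move=> /stage_mono[Es Ns]; exact: setUSS. Qed.

Lemma stage_union b : (forall a, ~ is_succ le a b) ->
  edges (stage b) = \bigcup_(a in [set a | lt a b]) edges (stage a) /\
  nonedges (stage b) = \bigcup_(a in [set a | lt a b]) nonedges (stage a).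
Proof.
move=> nb; rewrite stage_nosucc//; split=> //.
by rewrite nonedges_union// => c d cd _; exact: stage_mono.
Qed.

Lemma stage_union_determined b e : (forall a, ~ is_succ le a b) ->
  determined (stage b) e -> exists2 a, lt a b & determined (stage a) e.
Proof.
move=> /stage_union[Eb Nb]; rewrite /determined Eb Nb.
by move=> [] [a ab ea]; exists a => //; [left|right].
Qed.

(** A walk has finitely many edges, so one earlier stage contains them all. The case [x = y]
    accounts for the first stage, which has no earlier one. *)
Lemma stage_union_connects b x y : (forall a, ~ is_succ le a b) ->
  connects (edges (stage b)) x y ->
  x = y \/ exists2 a, lt a b & connects (edges (stage a)) x y.
Proof.
move=> /stage_union[Eb _]; rewrite Eb; elim=> [|u v e _ IH [a ab ea] uv]; first by left.
right; case: IH => [->|[c cb xu]]; first by exists a => //; exact: connects_edge uv.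
case: (wo_total a c) => h; [exists c => //|exists a => //].
  by apply: connects_step uv; [exact: xu|exact: (stage_mono h).1].
by apply: connects_step uv; [exact: connects_sub (stage_mono h).1 xu|].
Qed.

(** * The invariants along the play *)

Lemma stage_components_determined b : components_determined (stage b).
Proof.
elim/(well_founded_ind wo_lt_wf): b => b IH.
have [[a ab]|/forallNP nb] := pselect (exists a, is_succ le a b).
  by rewrite (stage_succ ab); apply: bob_components_determined; exact: IH ab.1.
move=> x y e /(stage_union_connects nb)[xy /joins_neq//|[a ab xy] exy].
exact: determined_mono ab.1 _ (IH a ab _ _ _ xy exy).
Qed.

(* At a limit, a finite component and the determination of the finitely many
   pairs between two finite components are already reached earlier. *)
Lemma stage_components_open b : components_open (stage b).
Proof.
elim/(well_founded_ind wo_lt_wf): b => b IH.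
have [[a ab]|/forallNP nb] := pselect (exists a, is_succ le a b).
  by rewrite (stage_succ ab); apply: bob_components_open; exact: IH ab.1.
move=> x y /finite_seqP[s sE] /finite_seqP[t tE] nxy.
have sP u : u \in s <-> connects (edges (stage b)) x u.
  by have := congr1 (fun A => A u) sE; rewrite /component /= => ->.
have tP u : u \in t <-> connects (edges (stage b)) y u.
  by have := congr1 (fun A => A u) tE; rewrite /component /= => ->.
apply: contrapT => none.
have det u v f : u \in s -> v \in t -> joins f u v -> determined (stage b) f.
  move=> /sP xu /tP yv fuv; apply: contrapT => ndf; apply: none.
  by exists u, v, f.
have [f fxy] : exists f, joins f x y.
  by apply: joins_exists => xy; apply: nxy; rewrite xy; exact: connects_refl.
have xs : x \in s by apply/sP; exact: connects_refl.
have yt : y \in t by apply/tP; exact: connects_refl.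
(* [b] is not the first stage, since the pair [f] is determined at [b]. *)
have ne : exists c, lt c b.
  by have [c cb _] := stage_union_determined nb (det _ _ _ xs yt fxy); exists c.
pose P (p : nat * nat) c := [/\ connects (edges (stage c)) x p.1,
  connects (edges (stage c)) y p.2 &
  forall f, joins f p.1 p.2 -> determined (stage c) f].
have Pmono p c d : le c d -> P p c -> P p d.
  move=> cd [xp yp pd]; have sub := (stage_mono cd).1.
  split; [exact: connects_sub xp|exact: connects_sub yp|].
  by move=> g /pd; exact: determined_mono.
have early z u : connects (edges (stage b)) z u ->
    exists2 c, lt c b & connects (edges (stage c)) z u.
  move=> /(stage_union_connects nb)[->|//].
  by have [c cb] := ne; exists c => //; exact: connects_refl.
have [|c cb cP] := @eventually_all _ P [seq (u, v) | u <- s, v <- t] b Pmono ne.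
  move=> p /allpairsP[[u v] /= [us vt ->]].
  have [c cb xu] := early _ _ ((sP u).1 us); have [d db yv] := early _ _ ((tP v).1 vt).
  have nuv : u <> v.
    move=> uv; apply: nxy; apply: connects_trans ((sP u).1 us) _.
    by rewrite uv; apply: connects_sym; exact: (tP v).1 vt.
  have [g guv] := joins_exists nuv.
  have [k kb gk] := stage_union_determined nb (det _ _ _ us vt guv).
  have [l lb [cl dl]] := lt_directed cb db; have [m mb [lm km]] := lt_directed lb kb.
  exists m => //; split.
  - exact: connects_sub (stage_mono (wo_trans cl lm)).1 xu.
  - exact: connects_sub (stage_mono (wo_trans dl lm)).1 yv.
  - by move=> h /(joins_unique guv) <-; exact: determined_mono km _ gk.
have sub := (stage_mono cb.1).1.
have fin z (w : seq nat) : component (edges (stage b)) z = [set` w] ->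
    finite_set (component (edges (stage c)) z).
  move=> zE; apply: (@sub_finite_set _ _ (component (edges (stage b)) z)).
    by move=> u; exact: connects_sub.
  by apply/finite_seqP; exists w.
(* The components at [c] lie inside those at [b], so the open pair given by the induction hypothesis
   has its endpoints in [s] and [t], where [cP] says it is determined. *)
case: (IH c cb x y (fin _ _ sE) (fin _ _ tE)).
  by move=> xy; apply: nxy; exact: connects_sub xy.
move=> u [v [g [xu yv guv]]]; apply.
have us : u \in s by apply/sP; exact: connects_sub xu.
have vt : v \in t by apply/tP; exact: connects_sub yv.
by have [_ _] := cP (u, v) (allpairs_f _ us vt); apply.
Qed.

(** * Legality of the moves and termination *)

Definition legal_at (a : I) : Prop :=
  ~ determined (stage a) (sigma (history le stage a)).

Lemma stage_follows b : (forall a, lt a b -> legal_at a) -> follows sigma le stage b.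
Proof.
move=> leg a c cb ac; rewrite (stage_succ ac); apply: bob_round; apply: leg.
exact: wo_lt_le_trans ac.1 cb.
Qed.

Lemma stage_play (R : set graph) b : (forall a, lt a b -> legal_at a) ->
  (forall a, lt a b -> ~ decided R (stage a)) -> play R le stage b.
Proof.
move=> leg und; split=> // [a ab afirst|a c cb ac|c cb [_ cl]].
- have [|-> ->] := @stage_union a; first by move=> c [ca _]; exact: afirst ca.
  by split; apply/seteqP; split=> // e [c /afirst].
- by exists (sigma (history le stage a)); exact: (stage_follows leg).
- exact: stage_union.
Qed.

(** A legal strategy is constrained only on histories of plays, hence the induction: legal moves
    before [b] make the stages up to [b] a play, which forces a legal move at [b]. *)
Lemma stage_legal (R : set graph) b : legal_strategy R sigma ->
  (forall a, le a b -> ~ decided R (stage a)) -> legal_at b.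
Proof.
move=> leg; elim/(well_founded_ind wo_lt_wf): b => b IH und.
apply: leg (und b (wo_refl b)); apply: stage_play => a ab; last exact: und ab.1.
by apply: IH => // c ca; apply: und; exact: wo_trans ab.1.
Qed.

(** A move is determined from the next stage on, so no later legal move repeats it. *)
Lemma alice_moves_inj : (forall a, legal_at a) ->
  injective (fun a => sigma (history le stage a)).
Proof.
move=> leg; have neq a b : lt a b ->
    sigma (history le stage a) <> sigma (history le stage b).
  move=> ab E; apply: (leg b); have [c ac cb] := succ_exists ab.
  apply: determined_mono cb _ _; rewrite (stage_succ ac); apply/bob_determined.
  by left.
move=> a b E; apply: contrapT => nab; case: (wo_total a b) => h.
  by apply: (neq a b).
by apply: (neq b a) => //; split=> // ?; apply: nab.
Qed.

End WellOrder.

(** Cantor's diagonal argument, with [D] built from the codes of the values of [f]. *)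
Lemma powerset_not_countable (T : countType) (f : set nat -> T) : ~ injective f.
Proof.
move=> finj; pose D := [set n | exists A, n = choice.pickle (f A) /\ ~ A n].
have [DD|nDD] := pselect (D (choice.pickle (f D))); last by apply: (nDD); exists D.
case: (DD) => A [/(pcan_inj choice.pickleK)/finj DA nA]; by rewrite -DA in nA.
Qed.

Theorem theorem4p15 : hard graph_connected F_omega2.
Proof.
move=> [sigma [leg win]].
have [le wo] := well_ordering_principle (set nat).
pose G := stage wo sigma.
(* [b] is the stage of termination. If there were none, Alice's moves would inject [set nat] into
   [vpair]. *)
have [|b db bmin] := @wo_min _ le wo (fun b => decided graph_connected (G b)).
  apply: contrapT => /forallNP und.
  apply: (@powerset_not_countable vpair _ (@alice_moves_inj _ le wo sigma _)).
  by move=> a; apply: stage_legal leg _ => c _; exact: und.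
have und a : stage_lt le a b -> ~ decided graph_connected (G a).
  by move=> ab /bmin ba; exact: wo_lt_irrefl (wo_lt_le_trans wo ab ba).
have legb a : stage_lt le a b -> legal_at wo sigma a.
  move=> ab; apply: stage_legal leg _ => c ca; apply: und.
  exact: wo_le_lt_trans ab.
apply: (win _ le G b) => //; [exact: stage_play|exact: stage_follows|].
apply: decided_F_omega2 db.
  exact: stage_components_determined.
exact: stage_components_open.
Qed.
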